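(* Let $\mathcal{H}$ be a separable Hilbert space, $I$ a countable index set, and let $W=\{(W_i,\omega_i)\}_{i\in I}$ be a fusion frame for $\mathcal{H}$ such that $\{W_i\}_{i\in I}$ is a fusion Riesz basis for $\mathcal{H}$. Let $V=\{(V_i,\omega_i)\}_{i\in I}$ be any dual fusion frame of $W$ (with the same weights $\omega_i$). Then $W$ and $V$ are woven.
   Context: $\pi_V$ is the orthogonal projection onto a closed subspace $V$. A family $\{(W_i,\omega_i)\}_{i\in I}$ of closed subspaces and weights $\omega_i>0$ is a fusion frame for $\mathcal{H}$ with bounds $C,D$ if $0<C\le D<\infty$ and $C\|f\|^2\le\sum_{i\in I}\omega_i^2\|\pi_{W_i}f\|^2\le D\|f\|^2$ for all $f\in\mathcal{H}$; it is a Bessel fusion sequence if the upper inequality holds for some $D<\infty$. The fusion frame operator is $S_Wf=\sum_{i\in I}\omega_i^2\pi_{W_i}f$, which is bounded, positive and invertible for a fusion frame. A family $\{W_i\}_{i\in I}$ of closed subspaces is a fusion Riesz sequence if there are constants $C,D>0$ with $C\sum_{i\in J}\|f_i\|^2\le\|\sum_{i\in J}f_i\|^2\le D\sum_{i\in J}\|f_i\|^2$ for every finite $J\subset I$ and all $f_i\in W_i$; it is a fusion Riesz basis for $\mathcal{H}$ if moreover $\overline{\operatorname{span}}\{W_i\}_{i\in I}=\mathcal{H}$. A Bessel fusion sequence $\{(V_i,\nu_i)\}_{i\in I}$ is a dual fusion frame of a fusion frame $W=\{(W_i,\omega_i)\}_{i\in I}$ if $f=\sum_{i\in I}\omega_i\nu_i\pi_{V_i}S_W^{-1}\pi_{W_i}f$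 for all $f\in\mathcal{H}$. Two fusion frames $\{(W_i,\omega_i)\}_{i\in I}$ and $\{(V_i,\nu_i)\}_{i\in I}$ are woven if there are universal constants $0<C\le D<\infty$ such that for every $\sigma\subset I$ the family $\{(W_i,\omega_i)\}_{i\in\sigma}\cup\{(V_i,\nu_i)\}_{i\in\sigma^c}$ is a fusion frame for $\mathcal{H}$ with bounds $C,D$. *)

(* Defs.v *)
From HB Require Import structures.
From mathcomp Require Import all_boot all_order all_algebra finmap.
From mathcomp Require Import sesquilinear complex.
From mathcomp Require Import all_classical all_reals all_analysis.
From mathcomp.analysis.showcase Require Import summability.

Set Implicit Arguments.
Unset Strict Implicit.
Unset Printing Implicit Defensive.

Import Order.TTheory GRing.Theory Num.Theory.
Import numFieldNormedType.Exports.

Local Open Scope classical_set_scope.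
Local Open Scope ring_scope.

(* Hilbert spaces are taken over either of the two usual scalar fields. *)
Variant scalar_kind := RealScalars | ComplexScalars.

Section Scalars.
Context (R : realType).

Definition hscalar (s : scalar_kind) : numFieldType :=
  match s with RealScalars => R | ComplexScalars => R[i] end.

Definition scalar_conj (s : scalar_kind) : hscalar s -> hscalar s :=
  match s with RealScalars => idfun | ComplexScalars => Num.conj end.

Definition scalar_Re (s : scalar_kind) : hscalar s -> R :=
  match s with RealScalars => idfun | ComplexScalars => @complex.Re R end.

Definition scalar_of (s : scalar_kind) : R -> hscalar s :=
  match s with
  | RealScalars => idfun
  | ComplexScalars => fun x => Complex x 0
  end.

End Scalars.

Section FusionFrames.
Context (R : realType) (s : scalar_kind).
Context (H : completeNormedModType (hscalar R s)).
Context (dot : {dot H for @scalar_conj R s}).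

(* The norm of H takes values in the scalar field; this is the same number
   seen in R. *)
Definition rnorm (x : H) : R := scalar_Re `|x|.

Definition subspace_set (V : set H) : Prop :=
  V 0 /\ forall (a : hscalar R s) (x y : H), V x -> V y -> V (a *: x + y).

Definition closed_subspace (V : set H) : Prop := subspace_set V /\ closed V.

Definition linear_span (A : set H) : set H := smallest subspace_set A.

(* The projection theorem provides such a point, and a unique one, when V is a
   closed subspace and dot induces the norm of H. *)
Definition orth_proj (V : set H) (f : H) : H :=
  xget 0 [set g | V g /\ forall h, V h -> dot (f - g) h = 0].

Context (I : countType).
Implicit Types (W V : I -> set H) (w v : I -> R).

Definition weighted_subspaces W w : Prop :=
  (forall i, closed_subspace (W i)) /\ (forall i, 0 < w i).

Definition fusion_sum W w (f : H) : \bar R :=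
  \esum_(i in [set: I]) (w i ^+ 2 * rnorm (orth_proj (W i) f) ^+ 2)%:E.

Definition fusion_frame_bounds W w (C D : R) : Prop :=
  [/\ weighted_subspaces W w, 0 < C, C <= D &
      forall f : H,
        ((C * rnorm f ^+ 2)%:E <= fusion_sum W w f <= (D * rnorm f ^+ 2)%:E)%E].

Definition fusion_frame W w : Prop :=
  exists C D : R, fusion_frame_bounds W w C D.

Definition bessel_fusion W w : Prop :=
  weighted_subspaces W w /\
  exists D : R, forall f : H, (fusion_sum W w f <= (D * rnorm f ^+ 2)%:E)%E.

(* Series over I are unconditional: [sum] is the limit of the partial sums
   along the finite subsets of I directed by inclusion. *)
Definition fusion_frame_op W w (f : H) : H :=
  sum (fun i => scalar_of s (w i ^+ 2) *: orth_proj (W i) f).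

(* Two-sided inverse when the operator is a bijection of H, as it is for a
   fusion frame. *)
Definition fusion_frame_op_inv W w : H -> H :=
  'pinv_(fun=> 0) [set: H] (fusion_frame_op W w).

Definition fusion_riesz_sequence W : Prop :=
  (forall i, closed_subspace (W i)) /\
  exists C D : R, [/\ 0 < C, 0 < D &
    forall (J : {fset I}) (f : I -> H), (forall i, i \in J -> W i (f i)) ->
      C * (\sum_(i <- J) rnorm (f i) ^+ 2) <= rnorm (\sum_(i <- J) f i) ^+ 2
        <= D * (\sum_(i <- J) rnorm (f i) ^+ 2)].

Definition fusion_riesz_basis W : Prop :=
  fusion_riesz_sequence W /\
  closure (linear_span (\bigcup_i W i)) = [set: H].

Definition dual_fusion_frame W w V v : Prop :=
  [/\ fusion_frame W w, bessel_fusion V v &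
      forall f : H,
        partial_sum (fun i => scalar_of s (w i * v i) *:
          orth_proj (V i) (fusion_frame_op_inv W w (orth_proj (W i) f)))
        @ totally --> f].

(* [patch V sigma W] is W on sigma and V on its complement. *)
Definition woven W w V v : Prop :=
  [/\ fusion_frame W w, fusion_frame V v &
      exists C D : R, [/\ 0 < C, C <= D &
        forall sigma : set I,
          fusion_frame_bounds (patch V sigma W) (patch v sigma w) C D]].

End FusionFrames.

(* Main.v *)
Require Import Defs.
From HB Require Import structures.
From mathcomp Require Import all_boot all_order all_algebra finmap.
From mathcomp Require Import sesquilinear complex.
From mathcomp Require Import all_classical all_reals all_analysis.
From mathcomp Require Import ring lra.
From mathcomp.analysis.showcase Require Import summability.

(* Write S for the fusion frame operator and T for its inverse.  Since
   f = sum_i w_i^2 p_(W i) (T f) is a decomposition of f along the W i, the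
   Riesz property makes it the only one, so for g in W j all the terms of the
   decomposition of g vanish except the j-th.  Testing the duality identity at
   w_j^2 T g then yields T g = p_(V j) (T g), that is, T (W j) is contained in
   V j, whence |p_(W j) (T f)| <= |p_(V j) f| / C.  Finally
   |f|^2 = sum_i w_i^2 <p_(W i) (T f), p_(W i) f>; bounding the terms by Young's
   inequality, with p_(W i) f kept on sigma and p_(V i) f kept on its
   complement, gives the universal lower bound C^2 / (2 D). *)

Set Implicit Arguments.
Unset Strict Implicit.
Unset Printing Implicit Defensive.

Import Order.TTheory GRing.Theory Num.Theory.
Import numFieldNormedType.Exports.

Local Open Scope classical_set_scope.
Local Open Scope ring_scope.

(** * Real parts of real and complex scalars *)

Section Scalars.
Context (R : realType) (s : scalar_kind).
Implicit Types (z : hscalar R s) (a : R).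

Lemma scalar_ReD z1 z2 : scalar_Re (z1 + z2) = scalar_Re z1 + scalar_Re z2.
Proof. by case: s z1 z2 => // -[? ?] [? ?]. Qed.

Lemma scalar_Re0 : scalar_Re (0 : hscalar R s) = 0.
Proof. by case: s. Qed.

Lemma scalar_ReM a z : scalar_Re (scalar_of s a * z) = a * scalar_Re z.
Proof. by case: s z => // -[x y] /=; rewrite mul0r subr0. Qed.

Lemma scalar_Re_conj z : scalar_Re (scalar_conj z) = scalar_Re z.
Proof. by case: s z => // -[]. Qed.

Lemma scalar_ofK a : scalar_Re (scalar_of s a) = a.
Proof. by case: s. Qed.

Lemma scalar_of_Re z : 0 <= z -> scalar_of s (scalar_Re z) = z.
Proof. by case: s z => // -[x y]; rewrite lecE /= => /andP[/eqP-> _]. Qed.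

Lemma scalar_Re_ge0 z : 0 <= z -> 0 <= scalar_Re z.
Proof. by case: s z => // -[x y]; rewrite lecE /= => /andP[]. Qed.

Lemma lt_scalar_of a1 a2 : (scalar_of s a1 < scalar_of s a2) = (a1 < a2).
Proof. by case: s => //=; rewrite ltcE /= eqxx. Qed.

Lemma scalar_of0 : scalar_of s 0 = 0 :> hscalar R s.
Proof. by case: s. Qed.

Lemma scalar_ofX a n : scalar_of s (a ^+ n) = scalar_of s a ^+ n.
Proof. by case: s => //=; exact: (rmorphXn (real_complex R)). Qed.

(** Taking [c] to be 1 and the imaginary unit reads off both coordinates of [z]; identities between
    real parts are upgraded to identities for [dot] in this way. *)
Lemma scalar_eq0 z : (forall c : hscalar R s, scalar_Re (c * z) = 0) -> z = 0.
Proof.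
case: s z => /= [z /(_ 1)|z h]; first by rewrite mul1r.
have := h 1; have := h 'i%C; case: z {h} => x y /=.
by rewrite !mul0r !mul1r sub0r subr0 => /eqP; rewrite oppr_eq0 => /eqP-> ->.
Qed.

End Scalars.

(** * The real inner product and convergence in [H] *)

Section InnerProduct.
Context (R : realType) (s : scalar_kind).
Context (H : completeNormedModType (hscalar R s)).
Context (dot : {dot H for @scalar_conj R s}).
Context (dot_norm : forall x : H, dot x x = `|x| ^+ 2).

Lemma dotC x y : dot x y = scalar_conj (dot y x).
Proof. by rewrite hermitian_subproof expr0 mul1r. Qed.

Lemma dotPl a x y z : dot (a *: x + y) z = a * dot x z + dot y z.
Proof. by rewrite linearDl linearZl_LR. Qed.

(** The real part is a symmetric real bilinear form inducing the same norm, so both scalar fields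
    share one argument and every estimate lives in [R]. *)
Definition rdot (x y : H) : R := scalar_Re (dot x y).
Local Notation "''[' x , y ]" := (rdot x y).
Local Notation "''[' x ]" := (rdot x x).

Lemma rdotC x y : '[x, y] = '[y, x].
Proof. by rewrite /rdot dotC scalar_Re_conj. Qed.

Lemma rdotDl x y z : '[x + y, z] = '[x, z] + '[y, z].
Proof. by rewrite /rdot linearDl scalar_ReD. Qed.

Lemma rdotZl a x y : '[scalar_of s a *: x, y] = a * '[x, y].
Proof. by rewrite /rdot linearZl_LR scalar_ReM. Qed.

Lemma rdot0l y : '[0, y] = 0.
Proof. by rewrite -(scale0r 0) -(scalar_of0 R s) rdotZl mul0r. Qed.

Lemma rdotNl x y : '[- x, y] = - '[x, y].
Proof. by apply/eqP; rewrite -addr_eq0 -rdotDl addNr rdot0l. Qed.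

Lemma rdotBl x y z : '[x - y, z] = '[x, z] - '[y, z].
Proof. by rewrite rdotDl rdotNl. Qed.

Lemma rdotDr x y z : '[z, x + y] = '[z, x] + '[z, y].
Proof. by rewrite rdotC rdotDl !(rdotC _ z). Qed.

Lemma rdotZr a x y : '[y, scalar_of s a *: x] = a * '[y, x].
Proof. by rewrite rdotC rdotZl rdotC. Qed.

Lemma rdotNr x y : '[y, - x] = - '[y, x].
Proof. by rewrite rdotC rdotNl rdotC. Qed.

Lemma rdotBr x y z : '[z, x - y] = '[z, x] - '[z, y].
Proof. by rewrite rdotDr rdotNr. Qed.

Definition rdotE := (rdotDl, rdotDr, rdotNl, rdotNr, rdotZl, rdotZr).

Lemma rdot_suml (T : Type) (r : seq T) (x : T -> H) y :
  '[\sum_(i <- r) x i, y] = \sum_(i <- r) '[x i, y].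
Proof.
by elim/big_rec2: _ => [|i a b _ <-]; rewrite ?rdot0l ?rdotDl.
Qed.

Lemma scalar_of_rnorm (x : H) : scalar_of s (rnorm x) = `|x|.
Proof. exact: scalar_of_Re. Qed.

Lemma rnorm_ge0 (x : H) : 0 <= rnorm x.
Proof. exact: scalar_Re_ge0. Qed.

Lemma rnorm_sqr (x : H) : rnorm x ^+ 2 = '[x].
Proof.
by rewrite /rdot dot_norm -(scalar_of_rnorm x) -scalar_ofX scalar_ofK.
Qed.

Lemma rdot_ge0 x : 0 <= '[x].
Proof. by rewrite -rnorm_sqr sqr_ge0. Qed.

Lemma rdot_eq0 x : '[x] = 0 -> x = 0.
Proof.
rewrite -rnorm_sqr => /eqP; rewrite sqrf_eq0 => /eqP x0; apply/eqP.
by rewrite -normr_eq0 -scalar_of_rnorm x0 scalar_of0.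
Qed.

Lemma lt_norm_rdot (x : H) e : 0 < e ->
  (`|x| < scalar_of s e) = ('[x] < e ^+ 2).
Proof.
move=> e0; rewrite -scalar_of_rnorm lt_scalar_of -rnorm_sqr.
by rewrite ltr_pXn2r// nnegrE ?rnorm_ge0// ltW.
Qed.

(** Expand the square of [t x - y] and divide by [t]. With a suitable [t] this does the work of
    Cauchy-Schwarz throughout. *)
Lemma rdot_young t x y : 0 < t -> 2 * '[x, y] <= t * '[x] + t^-1 * '[y].
Proof.
move=> t0; have := rdot_ge0 (scalar_of s t *: x - y).
rewrite rdotBl !rdotBr !rdotZl !rdotZr (rdotC y x) => h.
rewrite -(ler_pM2l t0) mulrDr mulVKf ?gt_eqF//; nra.
Qed.

Lemma rdotD_le (x y : H) : '[x + y] <= 2 * '[x] + 2 * '[y].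
Proof. by have := rdot_young x y ltr01; rewrite !rdotE (rdotC _ y); lra. Qed.

Lemma cvg_rdotP (T : Type) (F : set_system T) (FF : Filter F) (f : T -> H) l :
  f @ F --> l <-> forall e : R, 0 < e -> \forall t \near F, '[l - f t] < e.
Proof.
split=> [/cvgrPdist_lt h e e0|h].
  have se0 : 0 < Num.sqrt e by rewrite sqrtr_gt0.
  have /h : 0 < scalar_of s (Num.sqrt e) by rewrite -scalar_of0 lt_scalar_of.
  by apply: filterS => t; rewrite lt_norm_rdot// sqr_sqrtr// ltW.
apply/cvgrPdist_lt => e e0; have eE := scalar_of_Re (ltW e0).
rewrite -eE -[X in X < _](scalar_of0 R s) lt_scalar_of in e0; rewrite -eE.
have /h : 0 < scalar_Re e ^+ 2 by rewrite exprn_gt0.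
by apply: filterS => t; rewrite lt_norm_rdot.
Qed.

Lemma rdot_complete (F : set_system H) (FF : ProperFilter F) :
  (forall e : R, 0 < e -> exists x, F [set y | '[x - y] < e]) ->
  exists l : H, F --> l.
Proof.
move=> h; suff /cauchy_cvg/cvg_ex : cauchy F by [].
apply: cauchy_exP => e e0; have eE := scalar_of_Re (ltW e0).
rewrite -eE -[X in X < _](scalar_of0 R s) lt_scalar_of in e0; rewrite -eE.
have /h[x Fx] : 0 < scalar_Re e ^+ 2 by rewrite exprn_gt0.
exists x; rewrite -ball_normE; apply: filterS Fx => y /=.
by rewrite lt_norm_rdot.
Qed.

Lemma closed_filter_lim (F : set_system H) (FF : ProperFilter F) (V : set H) l :
  closed V -> F --> l -> F V -> V l.
Proof.
move=> clV Fl FV; apply: clV => B /Fl FB.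
by apply: (@filter_ex _ F); exact: filterI.
Qed.

Lemma cvg_rdot (T : Type) (F : set_system T) (FF : Filter F) (f : T -> H) l y :
  f @ F --> l -> (fun t => '[f t, y]) @ F --> '[l, y].
Proof.
move=> /cvg_rdotP h; apply/cvgrPdist_lt => e e0.
have y0 := rdot_ge0 y; have y1 : 0 < '[y] + 1 by lra.
have /h : 0 < e ^+ 2 / ('[y] + 1) by rewrite divr_gt0 ?exprn_gt0.
apply: filterS => t; rewrite -rdotBl ltr_pdivlMr// => lt_e.
set u := l - f t in lt_e *.
(* With this weight both terms of Young's inequality fall below [e]; the added 1 covers [y = 0]. *)
have t0 : 0 < ('[y] + 1) / e by rewrite divr_gt0.
have a1 : ('[y] + 1) / e * '[u] < e.
  by rewrite mulrAC ltr_pdivrMr// mulrC -expr2.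
have a2 : ((('[y] + 1) / e)^-1) * '[y] < e.
  by rewrite invf_div mulrAC ltr_pdivrMr// ltr_pM2l//; lra.
have := rdot_young u y t0; have := rdot_young (- u) y t0.
rewrite !rdotNl rdotNr opprK ltr_norml; lra.
Qed.

(** * Closed subspaces and the projection theorem *)

Lemma subspaceD (V : set H) x y : subspace_set V -> V x -> V y -> V (x + y).
Proof. by move=> [_ VP] Vx; rewrite -[x]scale1r; exact: VP. Qed.

Lemma subspaceZ (V : set H) a x : subspace_set V -> V x -> V (a *: x).
Proof. by move=> [V0 VP] Vx; rewrite -[_ *: _]addr0; exact: VP. Qed.

Lemma subspaceB (V : set H) x y : subspace_set V -> V x -> V y -> V (x - y).
Proof.
move=> sV Vx Vy; apply: subspaceD => //.
by rewrite -scaleN1r; exact: subspaceZ.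
Qed.

(** The filter of near-minimizers of the distance from [f] to [V] is Cauchy by the parallelogram
    law; perturbing along [h] forces orthogonality at its limit. *)
Lemma closest_point_orthogonal (V : set H) (f : H) : closed_subspace V ->
  exists2 g, V g & forall h, V h -> '[f - g, h] = 0.
Proof.
move=> [sV clV]; have [V0 _] := sV.
pose D := [set '[f - v] | v in V]; pose d := inf D.
have hD : has_inf D.
  split; first by exists '[f - 0], 0.
  by exists 0 => _ [v _ <-]; exact: rdot_ge0.
have d_le v : V v -> d <= '[f - v].
  by move=> Vv; apply: ge_inf; [exact: hD.2|exists v].
pose B e := [set v | V v /\ '[f - v] < d + e].
pose F := filter_from [set e : R | 0 < e] B.
have FF : ProperFilter F.
  apply: filter_from_proper => [|e /= e0].
    apply: filter_from_filter; first by exists 1 => /=.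
    move=> e1 e2 /= e10 e20; exists (Num.min e1 e2) => /=.
      by rewrite lt_min e10.
    move=> v [Vv]; rewrite /B/= => hv.
    split; split => //; apply: (lt_le_trans hv);
    by rewrite lerD2l ge_min lexx ?orbT.
  by have [_ [v Vv <-] hv] := inf_adherent e0 hD; exists v.
have [|l Fl] := @rdot_complete F FF.
  move=> e e0; have e40 : 0 < e / 4 by lra.
  have [_ [v Vv <-] hv] := inf_adherent e40 hD; exists v.
  exists (e / 4) => // w [Vw hw] /=.
  (* The midpoint lies in [V], so the parallelogram law bounds the squared distance of [v] and [w]
     by [4 (d + e / 4) - 4 d = e]. *)
  pose m := scalar_of s 2^-1 *: (v + w).
  have /d_le : V m by apply: subspaceZ => //; exact: subspaceD.
  rewrite -/d in hv; rewrite /m; move: hv hw.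
  rewrite !rdotE.
  rewrite !(rdotC v f) !(rdotC w f) !(rdotC w v); lra.
exists l.
  apply: (closed_filter_lim FF clV Fl); exists 1 => /=; first exact: ltr01.
  by move=> v [].
move=> h Vh; set c := '[f - l, h].
(* For [v] in the filter close to [l], add the bounds [d <= '[f - (v + a h)]] and [0 <=
   '[l - v + a h]]; the terms in [v] cancel up to [e]. *)
have key a : 2 * a * c <= 2 * a ^+ 2 * '[h].
  apply/ler_addgt0Pr => e e0; have e20 : 0 < e / 2 by lra.
  have /cvg_rdotP/(_ _ e20) Fe : id @ F --> l by [].
  have : F (B (e / 2)) by exists (e / 2).
  move=> /filterI/(_ Fe) /(@filter_ex _ F)[v [[Vv hv]]] /=.
  have /d_le : V (v + scalar_of s a *: h).
    by apply: subspaceD => //; exact: subspaceZ.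
  have := rdot_ge0 (l - v + scalar_of s a *: h).
  rewrite /c; move: hv.
  rewrite !rdotE.
  rewrite ?(rdotC v f) ?(rdotC h f) ?(rdotC h v) ?(rdotC l v) ?(rdotC h l); lra.
(* With [a = k] and [c = 2 k ('[h] + 1)] the bound becomes [k ^+ 2 * (2 * '[h] + 4) <= 0]. *)
have h0 := rdot_ge0 h; have := key (c / (2 * ('[h] + 1))).
have N0 : 0 < 2 * ('[h] + 1) by lra.
set k := c / _; have kE : c = k * (2 * ('[h] + 1)) by rewrite /k divfK ?gt_eqF.
rewrite {1}kE => h1; suff : k = 0 by rewrite kE => ->; rewrite mul0r.
apply/eqP; rewrite -sqrf_eq0 eq_le sqr_ge0 andbT; nra.
Qed.

(** * Orthogonal projections *)

Local Notation proj V := (orth_proj dot V).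

(** [V] contains every multiple [c *: h], so all the real parts of [c * dot h g] vanish, and with
    them the whole scalar. *)
Lemma rdot_eq0_dot (V : set H) g : subspace_set V ->
  (forall h, V h -> '[g, h] = 0) -> forall h, V h -> dot g h = 0.
Proof.
move=> sV g0 h Vh; rewrite dotC.
have -> : dot h g = 0.
  apply: scalar_eq0 => c; rewrite -linearZl_LR -/(rdot _ _) rdotC.
  by apply: g0; exact: subspaceZ.
by case: s => //=; exact: conjc0.
Qed.

Lemma orth_projP V f : closed_subspace V ->
  V (proj V f) /\ forall h, V h -> dot (f - proj V f) h = 0.
Proof.
move=> cV; have [g Vg fg0] := closest_point_orthogonal f cV.
apply: (@xgetPex _ 0 [set g | V g /\ forall h, V h -> dot (f - g) h = 0]).
by exists g; split => //; apply: rdot_eq0_dot => //; case: cV.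
Qed.

Lemma orth_proj_in V f : closed_subspace V -> V (proj V f).
Proof. by move=> /(orth_projP f)[]. Qed.

Lemma orth_proj_unique V f g : closed_subspace V -> V g ->
  (forall h, V h -> dot (f - g) h = 0) -> proj V f = g.
Proof.
move=> cV Vg fg; have [Vp fp] := orth_projP f cV.
apply/eqP; rewrite -subr_eq0; apply/eqP; apply: rdot_eq0.
have Vpg : V (proj V f - g) by apply: subspaceB => //; case: cV.
rewrite {1}(_ : proj V f - g = (f - g) - (f - proj V f)); last first.
  by rewrite opprB [RHS]addrC addrA subrK.
by rewrite rdotBl /rdot fg// fp// scalar_Re0 subrr.
Qed.

Lemma orth_proj_id V g : closed_subspace V -> V g -> proj V g = g.
Proof.
move=> cV Vg; apply: orth_proj_unique => // h _.
by rewrite subrr linear0l.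
Qed.

Lemma rdot_orth_proj V f h : closed_subspace V -> V h ->
  '[proj V f, h] = '[f, h].
Proof.
move=> cV Vh; have [_ fp] := orth_projP f cV.
have : '[f - proj V f, h] = 0 by rewrite /rdot (fp _ Vh) scalar_Re0.
by rewrite rdotBl => /eqP; rewrite subr_eq0 => /eqP.
Qed.

Lemma orth_projL V a f g : closed_subspace V ->
  proj V (a *: f + g) = a *: proj V f + proj V g.
Proof.
move=> cV; have [Vf fp] := orth_projP f cV; have [Vg gp] := orth_projP g cV.
apply: orth_proj_unique => //; first by case: cV => -[_ VP] _; exact: VP.
move=> h Vh; rewrite opprD addrACA -scalerBr dotPl.
by rewrite fp// gp// mulr0 addr0.
Qed.

Lemma orth_projZ V a f : closed_subspace V -> proj V (a *: f) = a *: proj V f.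
Proof.
move=> cV; rewrite -[a *: f]addr0 orth_projL// (@orth_proj_id _ 0) ?addr0//.
by case: cV => -[].
Qed.

Lemma rdot_proj2 V f g : closed_subspace V ->
  '[proj V f, g] = '[proj V f, proj V g].
Proof.
move=> cV; rewrite [RHS]rdotC (rdot_orth_proj g cV (orth_proj_in f cV)).
exact: rdotC.
Qed.

End InnerProduct.

(** * Sums over finite subsets and their suprema *)

Section NonnegativeSums.
Context (R : realType) (I : choiceType).
Implicit Types (a b : I -> R).

Lemma le_esum_fset a (J : {fset I}) :
  ((\sum_(i <- J) a i)%:E <= \esum_(i in [set: I]) (a i)%:E)%E.
Proof.
apply: esum_ge; exists [set` J]; first by split.
by rewrite fsbig_finite//= set_fsetK sumEFin.
Qed.

Lemma esum_le_fset a (M : \bar R) :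
  (forall J : {fset I}, ((\sum_(i <- J) a i)%:E <= M)%E) ->
  (\esum_(i in [set: I]) (a i)%:E <= M)%E.
Proof.
move=> aM; apply: ge_ereal_sup => _ [X [fX _] <-].
by rewrite fsbig_finite//= sumEFin.
Qed.

Lemma fset_sum_split (A : nmodType) (x : I -> A) (J0 J : {fset I}) :
  (J0 `<=` J)%fset ->
  \sum_(i <- J) x i = \sum_(i <- J0) x i + \sum_(i <- (J `\` J0)%fset) x i.
Proof.
move=> /fsubsetP J0J; rewrite (big_fsetID _ (mem J0)) /=.
congr (_ + _); apply: eq_fbigl => i; rewrite !inE /=; last by rewrite andbC.
by case: (boolP (i \in J0)) => [/J0J->|]; rewrite ?andbF.
Qed.

(** Take [J0] with partial sum within [e] of the supremum: whatever is added later is less than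
    [e]. *)
Lemma sum_fset_tail a (M : R) : (forall i, 0 <= a i) ->
  (forall J : {fset I}, \sum_(i <- J) a i <= M) ->
  forall e : R, 0 < e -> exists J0 : {fset I}, forall J : {fset I},
  (J0 `<=` J)%fset -> \sum_(i <- (J `\` J0)%fset) a i < e.
Proof.
move=> a0 aM e e0; pose A := [set \sum_(i <- J) a i | J in [set: {fset I}]].
have hA : has_sup A.
  split; first by exists (\sum_(i <- fset0) a i), fset0.
  by exists M => _ [J _ <-].
have [_ [J0 _ <-] hJ0] := sup_adherent e0 hA; exists J0 => J J0J.
have : \sum_(i <- J) a i <= sup A by apply: ub_le_sup; [exact: hA.2|exists J].
rewrite (fset_sum_split a J0J); lra.
Qed.

End NonnegativeSums.

Section UnconditionalSums.
Context (I : choiceType).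

Lemma partial_sum_fset (A : zmodType) (x : I -> A) :
  partial_sum x = fun J : {fset I} => \sum_(i <- J) x i.
Proof. by apply/funext => J; rewrite /partial_sum big_seq_fsetE. Qed.

Lemma near_totally (J0 : {fset I}) : \forall J \near totally, (J0 `<=` J)%fset.
Proof. by exists J0. Qed.

End UnconditionalSums.

#[local] Existing Instance totally_filter.

(** * The fusion frame operator of a Bessel family *)

Section FusionFrames.
Context (R : realType) (s : scalar_kind).
Context (H : completeNormedModType (hscalar R s)).
Context (dot : {dot H for @scalar_conj R s}).
Context (dot_norm : forall x : H, dot x x = `|x| ^+ 2).
Local Notation "''[' x , y ]" := (rdot dot x y).
Local Notation "''[' x ]" := (rdot dot x x).
Local Notation proj V := (orth_proj dot V).

Context (I : countType) (W : I -> set H) (w : I -> R).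
Context (cW : forall i, closed_subspace (W i)).

Lemma fusion_sumE f :
  fusion_sum dot W w f = \esum_(i in [set: I]) (w i ^+ 2 * '[proj (W i) f])%:E.
Proof. by apply: eq_esum => i _; rewrite (rnorm_sqr dot_norm). Qed.

Lemma young_sum (J : {fset I}) (t : R) (x y : I -> H) : 0 < t ->
  2 * \sum_(i <- J) w i ^+ 2 * '[x i, y i] <=
  t * (\sum_(i <- J) w i ^+ 2 * '[x i]) +
  t^-1 * (\sum_(i <- J) w i ^+ 2 * '[y i]).
Proof.
move=> t0; rewrite !mulr_sumr -big_split; apply: ler_sum => i _ /=.
have := rdot_young dot_norm (x i) (y i) t0.
by move=> /(ler_wpM2l (sqr_ge0 (w i))); rewrite mulrDr !(mulrCA (w i ^+ 2)).
Qed.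

Lemma rdot_fusion_partial (J : {fset I}) f g :
  '[\sum_(i <- J) scalar_of s (w i ^+ 2) *: proj (W i) f, g] =
  \sum_(i <- J) w i ^+ 2 * '[proj (W i) f, proj (W i) g].
Proof.
rewrite rdot_suml; apply: eq_bigr => i _.
by rewrite rdotZl (rdot_proj2 dot_norm).
Qed.

Context (D : R).
Context (D0 : 0 < D).
Context (bessel : forall f (J : {fset I}),
  \sum_(i <- J) w i ^+ 2 * '[proj (W i) f] <= D * '[f]).

(** Write ['[u]] as the sum of [w i ^+ 2 * '[proj (W i) f, proj (W i) u]]. Young's inequality with
    weight [D] and the Bessel bound at [u] cost one copy of ['[u]], absorbed on the left. *)
Lemma fusion_partial_bound (J : {fset I}) f :
  '[\sum_(i <- J) scalar_of s (w i ^+ 2) *: proj (W i) f] <=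
  D * \sum_(i <- J) w i ^+ 2 * '[proj (W i) f].
Proof.
set u := (X in '[X]); have uE := rdot_fusion_partial J f u; rewrite -/u in uE.
have := young_sum J (fun i => proj (W i) f) (fun i => proj (W i) u) D0.
rewrite -uE; have := bessel u J; rewrite -(ler_pdivrMl _ _ D0).
lra.
Qed.

(** The partial sums are Cauchy: a tail is controlled by [D] times a tail of a bounded nonnegative
    series. *)
Lemma fusion_op_cvg f :
  partial_sum (fun i => scalar_of s (w i ^+ 2) *: proj (W i) f) @ totally
  --> fusion_frame_op dot W w f.
Proof.
set x := fun i => _.
suff [l xl] : exists l : H, partial_sum x @ totally --> l.
  by rewrite /fusion_frame_op /sum -/x (cvg_lim _ xl)//; exact: norm_hausdorff.
apply: (rdot_complete dot_norm) => e e0.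
have a0 i : 0 <= w i ^+ 2 * '[proj (W i) f].
  by rewrite mulr_ge0 ?sqr_ge0// rdot_ge0.
have eD0 : 0 < e / D by rewrite divr_gt0.
have [J0 hJ0] := sum_fset_tail a0 (bessel f) eD0.
exists (partial_sum x J0); exists J0 => // J /= J0J.
rewrite partial_sum_fset (fset_sum_split x J0J) opprD addrA subrr sub0r.
rewrite rdotNl rdotNr opprK; apply: le_lt_trans (fusion_partial_bound _ _) _.
by rewrite mulrC -ltr_pdivlMr//; exact: hJ0.
Qed.

Lemma rdot_fusion_op_cvg f g :
  (fun J : {fset I} => \sum_(i <- J) w i ^+ 2 * '[proj (W i) f, proj (W i) g])
  @ totally --> '[fusion_frame_op dot W w f, g].
Proof.
under eq_fun do rewrite -rdot_fusion_partial.
have := @fusion_op_cvg f; rewrite partial_sum_fset; exact: cvg_rdot.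
Qed.

Local Notation S := (fusion_frame_op dot W w).

Lemma fusion_op_linear a f g : S (a *: f + g) = a *: S f + S g.
Proof.
apply: (cvg_unique (@norm_hausdorff _ H) (@fusion_op_cvg _)).
pose x h (J : {fset I}) := \sum_(i <- J) scalar_of s (w i ^+ 2) *: proj (W i) h.
rewrite partial_sum_fset (_ : (fun J => _) = fun J => a *: x f J + x g J).
  by apply: cvgD; [apply: cvgZr|]; rewrite /x -partial_sum_fset;
    exact: fusion_op_cvg.
apply/funext => J; rewrite scaler_sumr -big_split; apply: eq_bigr => i _ /=.
by rewrite (orth_projL dot_norm)// scalerDr !scalerA mulrC.
Qed.

Lemma fusion_op_sym f g : '[S f, g] = '[f, S g].
Proof.
rewrite [RHS]rdotC.
apply: (cvg_unique (@Rhausdorff R) (@rdot_fusion_op_cvg f g)).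
rewrite (_ : (fun J => _) = fun J : {fset I} =>
  \sum_(i <- J) w i ^+ 2 * '[proj (W i) g, proj (W i) f]).
  exact: rdot_fusion_op_cvg.
by apply/funext => J; apply: eq_bigr => i _; rewrite rdotC.
Qed.

Lemma fusion_op_bounded f : '[S f] <= D ^+ 2 * '[f].
Proof.
suff : 2 * '[S f, S f] <= D * (D * '[f]) + D^-1 * (D * '[S f]).
  by rewrite [D^-1 * _]mulrA mulVf ?gt_eqF// expr2; lra.
rewrite -ler_pdivlMl//.
apply: (cvgr_to_le (@rdot_fusion_op_cvg f (S f))); near=> J.
rewrite ler_pdivlMl//; apply: le_trans (young_sum _ _ _ D0) _.
by rewrite lerD// ler_pM2l ?invr_gt0// bessel.
Unshelve. all: by end_near. Qed.

(** The partial sums of the left side increase and converge to ['[S f, f]], so none exceeds it. *)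
Lemma fusion_sum_le_op f : (fusion_sum dot W w f <= '[S f, f]%:E)%E.
Proof.
rewrite fusion_sumE; apply: esum_le_fset => J; rewrite lee_fin.
apply: (cvgr_to_ge (@rdot_fusion_op_cvg f f)).
apply: filterS (near_totally J) => K JK; rewrite (fset_sum_split _ JK) lerDl.
by apply: sumr_ge0 => i _; rewrite mulr_ge0 ?sqr_ge0// rdot_ge0.
Qed.

(** * Invertibility of the frame operator *)

Context (C : R).
Context (C0 : 0 < C).
Context (coercive :
  forall f, ((C * '[f])%:E <= fusion_sum dot W w f)%E).

Local Notation T := (fusion_frame_op_inv dot W w).

(** Combine [C * '[f] <= '[S f, f]] with Young's inequality of weight [C^-1], which turns half of
    the right side back into [C * '[f]]. *)
Lemma fusion_op_below f : C ^+ 2 * '[f] <= '[S f].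
Proof.
have : C * '[f] <= '[S f, f].
  rewrite -lee_fin; apply: le_trans (coercive f) _.
  exact: fusion_sum_le_op.
have Ci : 0 < C^-1 by rewrite invr_gt0.
have := rdot_young dot_norm (S f) f Ci; rewrite invrK => h1 h2.
have : C * '[f] <= C^-1 * '[S f] by lra.
by rewrite ler_pdivlMl// mulrA.
Qed.

Lemma fusion_op0 : S 0 = 0.
Proof.
apply: (rdot_eq0 dot_norm); apply/eqP; rewrite eq_le rdot_ge0// andbT.
apply: le_trans (fusion_op_bounded 0) _.
by rewrite rdot0l mulr0.
Qed.

Lemma fusion_opB f g : S (f - g) = S f - S g.
Proof.
rewrite addrC -scaleN1r fusion_op_linear.
by rewrite scaleN1r addrC.
Qed.

Lemma fusion_op_inj f g : S f = S g -> f = g.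
Proof.
move=> Sfg; apply/eqP; rewrite -subr_eq0; apply/eqP; apply: (rdot_eq0 dot_norm).
have := fusion_op_below (f - g); rewrite fusion_opB Sfg subrr rdot0l.
rewrite pmulr_rle0 ?exprn_gt0// => h.
by apply/eqP; rewrite eq_le h rdot_ge0//.
Qed.

(** For [y] in the closure, approximate preimages of [y] form a filter that is Cauchy because [S] is
    bounded below; boundedness of [S] sends its limit to [y]. *)
Lemma fusion_op_closed_range : closed_subspace (range S).
Proof.
split; first split.
- by exists 0; rewrite ?fusion_op0.
- move=> a _ _ [x _ <-] [y _ <-]; exists (a *: x + y) => //.
  exact: fusion_op_linear.
move=> y cly; pose F := filter_from [set e : R | 0 < e]
  (fun e => [set x | '[y - S x] < e]).
have FF : ProperFilter F.
  apply: filter_from_proper => [|e /= e0].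
    apply: filter_from_filter; first by exists 1 => /=.
    move=> e1 e2 /= e10 e20; exists (Num.min e1 e2) => /=.
      by rewrite lt_min e10.
    by move=> x /=; rewrite lt_min => /andP[].
  have /(cvg_rdotP dot_norm)/(_ _ e0)/cly[_ [[x _ <-] /= hx]] :
    id @ nbhs y --> y by [].
  by exists x.
have [|x Fx] := @rdot_complete _ _ _ _ dot_norm F FF.
  (* [C ^+ 2 * '[x - z]] is at most twice the sum of two squared errors, hence the division by 4. *)
  move=> e e0; have e1 : 0 < C ^+ 2 * e / 4.
    by rewrite divr_gt0// mulr_gt0// exprn_gt0.
  have [x hx] : exists x, '[y - S x] < C ^+ 2 * e / 4.
    by apply: (@filter_ex _ F); exists (C ^+ 2 * e / 4).
  exists x; exists (C ^+ 2 * e / 4) => // z /= hz.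
  rewrite -(ltr_pM2l (exprn_gt0 2 C0)).
  apply: le_lt_trans (fusion_op_below _) _.
  rewrite fusion_opB (_ : S x - S z = (y - S z) + - (y - S x)); last first.
    by rewrite opprB [RHS]addrC addrA subrK.
  apply: le_lt_trans (rdotD_le dot_norm _ _) _.
  by rewrite rdotNl rdotNr opprK; lra.
exists x => //; apply/esym/eqP; rewrite -subr_eq0; apply/eqP.
apply: (rdot_eq0 dot_norm); apply/eqP; rewrite eq_le rdot_ge0// andbT.
apply/ler_addgt0Pr => e e0; rewrite add0r.
(* The factor collects [2 * '[y - S z]] and [2 * '[S (x - z)]], the latter bounded through
   [D ^+ 2]. *)
have N0 : 0 < 2 + 2 * D ^+ 2 by have := sqr_ge0 D; lra.
pose k := e / (2 + 2 * D ^+ 2); have k0 : 0 < k by rewrite divr_gt0.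
have eE : e = k * (2 + 2 * D ^+ 2) by rewrite /k divfK ?gt_eqF.
have /(cvg_rdotP dot_norm)/(_ _ k0) Fk : id @ F --> x by [].
have : F [set x | '[y - S x] < k] by exists k.
move=> /filterI/(_ Fk) /(@filter_ex _ F)[z [/= h1 h2]].
rewrite (_ : y - S x = (y - S z) + - (S (x - z))); last first.
  by rewrite fusion_opB opprB addrA subrK.
apply: le_trans (rdotD_le dot_norm _ _) _; rewrite rdotNl rdotNr opprK eE.
have := fusion_op_bounded (x - z).
have := ler_wpM2l (sqr_ge0 D) (ltW h2); lra.
Qed.

(** The residual [y] of projecting [f] onto the range is orthogonal to [S y], so coercivity makes it
    zero. *)
Lemma fusion_op_surj f : exists x, S x = f.
Proof.
have [_ [x _ <-] hx] :=
  closest_point_orthogonal dot_norm f fusion_op_closed_range.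
exists x; apply/esym/eqP; rewrite -subr_eq0; apply/eqP; set y := f - S x.
apply: (rdot_eq0 dot_norm); apply/eqP; rewrite eq_le rdot_ge0// andbT.
have : '[S y, y] = 0 by rewrite rdotC; apply: hx; exists y.
move=> Sy0; have : ((C * '[y])%:E <= 0%:E)%E.
  rewrite -[X in (_ <= X%:E)%E]Sy0; apply: le_trans (coercive y) _.
  exact: fusion_sum_le_op.
by rewrite lee_fin pmulr_rle0.
Qed.

Lemma fusion_op_invK f : S (T f) = f.
Proof.
have [x <-] := fusion_op_surj f.
by apply: (@pinvK _ _ (fun=> 0) [set: H] S); rewrite inE; exists x.
Qed.

Lemma fusion_op_inv_eq f x : S x = f -> T f = x.
Proof. by move=> Sx; apply: fusion_op_inj; rewrite fusion_op_invK. Qed.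

Lemma fusion_op_inv_bounded f : C ^+ 2 * '[T f] <= '[f].
Proof. by have := fusion_op_below (T f); rewrite fusion_op_invK. Qed.

Lemma fusion_op_inv_sym f g : '[T f, g] = '[f, T g].
Proof.
have := fusion_op_sym (T f) (T g).
by rewrite !fusion_op_invK => ->.
Qed.

(** * Consequences of the Riesz property and duality *)

Section RieszDuality.
Context (w0 : forall i, 0 < w i).
Context (c : R).
Context (c0 : 0 < c).
Context (riesz : forall (J : {fset I}) (f : I -> H),
  (forall i, i \in J -> W i (f i)) ->
  c * \sum_(i <- J) '[f i] <= '[\sum_(i <- J) f i]).

Lemma fset_sum_single (A : nmodType) (j : I) (a : A) (J : {fset I}) :
  j \in J -> \sum_(i <- J) (if i == j then a else 0) = a.
Proof.
move=> jJ; rewrite (big_fsetD1 j jJ) /= eqxx big_seq big1 ?addr0// => i.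
by rewrite !inE => /andP[/negPf->].
Qed.

(** Both sides, as families in [i], decompose [g] along the subspaces [W i]; the lower Riesz bound
    makes such a decomposition unique. *)
Lemma riesz_proj_inv j g : W j g -> forall i,
  scalar_of s (w i ^+ 2) *: proj (W i) (T g) = if i == j then g else 0.
Proof.
move=> Wg i; pose u k := scalar_of s (w k ^+ 2) *: proj (W k) (T g).
pose v k : H := if k == j then g else 0.
have Wuv k : W k (u k - v k).
  have sW : subspace_set (W k) by case: (cW k).
  apply: subspaceB => //.
    by apply: subspaceZ => //; exact: (orth_proj_in dot_norm).
  by rewrite /v; case: eqP => [->|_]//; case: sW.
apply/eqP; rewrite -subr_eq0; apply/eqP; apply: (rdot_eq0 dot_norm).
rewrite -/(u i) -/(v i).
suff : c * '[u i - v i] <= 0.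
  by rewrite pmulr_rle0// => h; apply/eqP; rewrite eq_le h rdot_ge0//.
apply/ler_addgt0Pr => e e0; rewrite add0r.
have /(cvg_rdotP dot_norm)/(_ _ e0) :=
  @fusion_op_cvg (T g).
rewrite fusion_op_invK partial_sum_fset => -[J0 _].
(* Adding [j] makes the sum of [v] over [J] equal to [g]; adding [i] puts the term under study
   inside the Riesz sum. *)
move=> /(_ (J0 `|` [fset i; j])%fset (fsubsetUl _ _)) /=.
set J := (_ `|` _)%fset.
have iJ : i \in J by rewrite !inE eqxx orbT.
have jJ : j \in J by rewrite !inE eqxx !orbT.
rewrite -opprB rdotNl rdotNr opprK.
rewrite -[X in '[_ - X]](fset_sum_single g jJ) -sumrB.
move=> he; have := @riesz J _ (fun k _ => Wuv k).
rewrite (big_fsetD1 i iJ) /= => hr; apply: le_trans (ltW he).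
apply: le_trans hr; rewrite ler_pM2l// lerDl.
by apply: sumr_ge0 => k _; exact: rdot_ge0.
Qed.

Context (V : I -> set H).
Context (cV : forall i, closed_subspace (V i)).
Context (dual : forall f, partial_sum (fun i => scalar_of s (w i * w i) *:
  proj (V i) (T (proj (W i) f))) @ totally --> f).

Lemma fusion_op_inv_mem_dual j g : W j g -> V j (T g).
Proof.
move=> Wg; pose a : hscalar R s := scalar_of s (w j ^+ 2).
have a0 i : scalar_of s (w i ^+ 2) != 0.
  by rewrite gt_eqF// -(scalar_of0 R s) lt_scalar_of exprn_gt0.
have pE i : proj (W i) (a *: T g) = if i == j then g else 0.
  have := riesz_proj_inv Wg i; rewrite (orth_projZ dot_norm)//.
  case: eqP => [->//|_] /eqP; rewrite scaler_eq0 (negPf (a0 i)) /= => /eqP ->.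
  exact: scaler0.
have T0 : T 0 = 0 by apply: fusion_op_inv_eq; exact: fusion_op0.
suff : a *: T g = a *: proj (V j) (T g).
  by move/(scalerI (a0 j)) => ->; exact: (orth_proj_in dot_norm).
apply: (cvg_unique (@norm_hausdorff _ H) (@dual (a *: T g))).
apply/(cvg_rdotP dot_norm) => e e0.
(* Once [J] contains [j], the partial sum equals the claimed limit exactly, since only the [j]-th
   term survives. *)
apply: filterS (near_totally [fset j]%fset) => J; rewrite fsub1set => jJ.
rewrite partial_sum_fset -[X in '[X - _]](fset_sum_single _ jJ).
rewrite (_ : \sum_(i <- J) _ = \sum_(i <- J) scalar_of s (w i * w i) *:
    proj (V i) (T (proj (W i) (a *: T g)))) ?subrr ?rdot0l//.
apply: eq_bigr => i _; rewrite pE; case: eqP => [->|_]; first by rewrite -expr2.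
rewrite T0 (orth_proj_id dot_norm) ?scaler0//.
by case: (cV i) => -[].
Qed.

(** Symmetry of [T] and membership of [T g] in [V i] give ['[g] = '[proj (V i) f, T g]]. In Young's
    inequality [C ^+ 2 * '[T g]] is at most ['[g]], which is absorbed. *)
Lemma proj_inv_le_dual_proj i f :
  '[proj (W i) (T f)] <= (C ^+ 2)^-1 * '[proj (V i) f].
Proof.
set g := proj (W i) (T f).
have Wg : W i g by exact: (orth_proj_in dot_norm).
have gE : '[g] = '[proj (V i) f, T g].
  rewrite (rdot_orth_proj dot_norm)//; last exact: fusion_op_inv_mem_dual.
  by rewrite -fusion_op_inv_sym; exact: (rdot_orth_proj dot_norm).
have C2 : 0 < (C ^+ 2)^-1 by rewrite invr_gt0 exprn_gt0.
have := rdot_young dot_norm (proj (V i) f) (T g) C2.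
by rewrite -gE invrK; have := fusion_op_inv_bounded g; lra.
Qed.

(** The real [r] stands for any finite upper bound of the woven sum, so no extended reals enter the
    estimate. *)
Lemma weaving_lower_bound (sigma : set I) (f : H) (r : R) :
  (forall J : {fset I},
    \sum_(i <- J) w i ^+ 2 * '[proj (patch V sigma W i) f] <= r) ->
  C ^+ 2 / (2 * D) * '[f] <= r.
Proof.
move=> hr; pose t := C ^+ 2 / (2 * D).
have C20 : 0 < C ^+ 2 by rewrite exprn_gt0.
have t0 : 0 < t by rewrite divr_gt0// mulr_gt0.
have u0 : 0 < (2 * D)^-1 by rewrite invr_gt0 mulr_gt0.
(* The weight is [t] on [sigma] and [(2 * D)^-1] off it. The first two terms then sum to at most
   ['[f] / 2] each, leaving one of the two copies of ['[f]]. *)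
have term i : 2 * '[proj (W i) (T f), proj (W i) f] <=
    t * '[proj (W i) (T f)] + (2 * D)^-1 * '[proj (W i) f] +
    t^-1 * '[proj (patch V sigma W i) f].
  rewrite /patch; case: ifP => _.
    apply: le_trans (rdot_young dot_norm _ _ t0) _.
    rewrite -addrA lerD2l lerDr.
    by rewrite mulr_ge0 ?(ltW u0)// rdot_ge0.
  rewrite rdotC; apply: le_trans (rdot_young dot_norm _ _ u0) _.
  have D20 : 0 < 2 * D by rewrite mulr_gt0.
  have := ler_wpM2l (ltW D20) (proj_inv_le_dual_proj i f).
  have := mulr_ge0 (ltW t0) (rdot_ge0 dot_norm (proj (W i) (T f))).
  by rewrite mulrA /t invf_div invrK; lra.
have tD x : t * (D * x) = C ^+ 2 * x / 2.
  by rewrite /t; field; rewrite gt_eqF.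
have uD x : (2 * D)^-1 * (D * x) = x / 2 by field; rewrite gt_eqF.
rewrite -/t mulrC -ler_pdivlMr// mulrC.
suff : 2 * '[f] <= '[f] + t^-1 * r by lra.
rewrite -ler_pdivlMl//.
have := @rdot_fusion_op_cvg (T f) f.
rewrite fusion_op_invK => /cvgr_to_le; apply; near=> J.
rewrite ler_pdivlMl// mulr_sumr.
apply: (@le_trans _ _ (\sum_(i <- J) (t * (w i ^+ 2 * '[proj (W i) (T f)]) +
  (2 * D)^-1 * (w i ^+ 2 * '[proj (W i) f]) +
  t^-1 * (w i ^+ 2 * '[proj (patch V sigma W i) f])))).
  by apply: ler_sum => i _; have := ler_wpM2l (sqr_ge0 (w i)) (term i); lra.
rewrite !big_split /= -!mulr_sumr.
apply: lerD; last by rewrite ler_pM2l ?invr_gt0.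
have h1 := ler_wpM2l (ltW t0) (bessel (T f) J).
have h2 := ler_wpM2l (ltW u0) (bessel f J).
rewrite tD in h1; rewrite uD in h2.
by have := fusion_op_inv_bounded f; lra.
Unshelve. all: by end_near. Qed.

End RieszDuality.

End FusionFrames.

(** * Universal bounds for all weavings *)

Theorem theorem2p8 (R : realType) (s : scalar_kind)
    (H : completeNormedModType (hscalar R s))
    (dot : {dot H for @scalar_conj R s})
    (dot_norm : forall x : H, dot x x = `|x| ^+ 2)
    (H_separable : exists2 A : set H, countable A & dense A)
    (I : countType) (W V : I -> set H) (w : I -> R) :
  fusion_frame dot W w ->
  fusion_riesz_basis W ->
  dual_fusion_frame dot W w V w ->
  woven dot W w V w.
Proof.
move=> frW [[_ [c [d [c0 _ riesz]]]] _] [_ [[cV _] [B besV]] dual].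
have [C [D [[cW w0] C0 CD frame]]] := frW.
have D0 : 0 < D := lt_le_trans C0 CD.
have patchw sigma : patch w sigma w = w.
  by apply/funext => i; rewrite /patch if_same.
have fset_le U M f (J : {fset I}) :
    (fusion_sum dot U w f <= (M * rnorm f ^+ 2)%:E)%E ->
    \sum_(i <- J) w i ^+ 2 *
      rdot dot (orth_proj dot (U i) f) (orth_proj dot (U i) f) <=
    M * rdot dot f f.
  rewrite (rnorm_sqr dot_norm) (fusion_sumE dot_norm) -lee_fin.
  by apply: le_trans; exact: le_esum_fset.
have bessel f J : _ := fset_le W D f J (proj2 (andP (frame f))).
have besselV f J : _ := fset_le V B f J (besV f).
have coercive f : ((C * rdot dot f f)%:E <= fusion_sum dot W w f)%E.
  by have /andP[] := frame f; rewrite (rnorm_sqr dot_norm).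
have rieszr (J : {fset I}) (f : I -> H) : (forall i, i \in J -> W i (f i)) ->
    c * \sum_(i <- J) rdot dot (f i) (f i) <=
    rdot dot (\sum_(i <- J) f i) (\sum_(i <- J) f i).
  move=> /riesz /andP[+ _]; rewrite (rnorm_sqr dot_norm).
  by under eq_bigr do rewrite (rnorm_sqr dot_norm).
(* Each woven term is at most the sum of the [W] and [V] terms, hence the upper bound; the absolute
   value is there because [B] comes without a sign. *)
pose C' := C ^+ 2 / (2 * D); pose D' := D + `|B|.
have woven_bounds sigma :
    fusion_frame_bounds dot (patch V sigma W) (patch w sigma w) C' D'.
  rewrite patchw; split.
  - by split => // i; rewrite /patch; case: ifP.
  - by rewrite divr_gt0 ?mulr_gt0 ?exprn_gt0.
  - apply: (@le_trans _ _ D); last by rewrite lerDl.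
    by rewrite ler_pdivrMr ?mulr_gt0//; nra.
  move=> f; rewrite (rnorm_sqr dot_norm) (fusion_sumE dot_norm).
  apply/andP; split.
    set M := (X in (_ <= X)%E).
    have hM (J : {fset I}) : ((\sum_(i <- J) w i ^+ 2 *
        rdot dot (orth_proj dot (patch V sigma W i) f)
                 (orth_proj dot (patch V sigma W i) f))%:E <= M)%E.
      exact: le_esum_fset.
    (* An infinite sum satisfies the lower bound trivially, and the empty partial sum rules out
       [-oo]. *)
    case: M hM => [r| |] hM; last 2 first.
    - by rewrite leey.
    - by have := hM fset0.
    rewrite lee_fin.
    apply: (weaving_lower_bound dot_norm cW D0 bessel C0 coercive w0 c0 rieszr
      cV dual) => J.
    by rewrite -lee_fin; exact: hM.
  apply: esum_le_fset => J; rewrite lee_fin mulrDl.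
  apply: le_trans (lerD (bessel f J) (le_trans (besselV f J) _)); last first.
    by rewrite ler_wpM2r ?ler_norm// (rdot_ge0 dot_norm).
  rewrite -big_split; apply: ler_sum => i _ /=.
  rewrite -mulrDr ler_wpM2l ?sqr_ge0//.
  by rewrite /patch; case: ifP => _; rewrite ?lerDl ?lerDr (rdot_ge0 dot_norm).
have [_ C'0 C'D' _] := woven_bounds set0.
split => //; last by exists C', D'.
(* The weaving with empty [sigma] is [V] itself, which is therefore a fusion frame. *)
exists C', D'; have := woven_bounds set0; rewrite patchw.
rewrite (_ : patch V set0 W = V)//.
by apply/funext => i; rewrite /patch in_set0.
Qed.
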